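(* Let $\{F_i\}_{i=0}^n$ be a $\Delta(n,c)$ basis, let $a_0,\dots,a_n\in\mathbb{C}$ with $a_0\neq0$, $p(x)=\sum_{i=0}^n a_iF_i(x)$, and let $\mu\ge1$ be the multiplicity of the zero of $p$ at $c$ (so $p^{(j)}(c)=0$ for $j<\mu$; necessarily $\mu\le n$). Then $$\sum_{i=0}^n|a_i|^2\ \ge\ \frac{(n-\mu)!\,(n+\mu)!}{(n!)^2}\,|a_0|^2\ \ge\ e^{2\mu^2/(2n+1)}|a_0|^2,$$ $$1+\max_{1\le k\le n}\left|\frac{a_k}{a_0}\right|\ \ge\ \frac{(n-m)!\,(n+m)!}{(n!)^2}\ \ge\ \exp\!\left(\frac{2m^2}{2n+1}\right),\qquad m=\left\lfloor\frac{\mu+1}{2}\right\rfloor,$$ and, for every $0<q<\infty$, $$\sum_{i=0}^n\frac{|a_i|^2q^{-i}}{\binom{n}{i}}\ \ge\ \frac{|a_0|^2}{1-(1+q)^{-n}\sum_{i=0}^{\mu-1}\binom{n}{i}q^i}.$$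
   Context: $\mathcal{P}^m$ denotes the set of complex polynomials of degree at most $m$. A sequence $F_0,\dots,F_n$ of functions analytic in an open disc centered at $c\in\mathbb{C}$ is a $\Delta(n,c)$ basis if there are polynomials $R_0,\dots,R_n$ with $\deg R_j=j$ (so $R_0,\dots,R_k$ form a basis of $\mathcal{P}^k$ for each $k\le n$) such that $F_i^{(j)}(c)=R_j(i)$ for all $i,j\in\{0,1,\dots,n\}$. (Example: $F_i(x)=x^i$ with $c=1$, so $p$ is an ordinary polynomial of degree $\le n$.) *)

(* Defs.v *)
From HB Require Import structures.
From mathcomp Require Import all_boot all_order all_algebra.
From mathcomp Require Import complex.
From mathcomp Require Import all_classical all_reals all_analysis.
Set Implicit Arguments. Unset Strict Implicit. Unset Printing Implicit Defensive.
Import Order.TTheory GRing.Theory Num.Theory numFieldNormedType.Exports.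
Local Open Scope ring_scope.
Local Open Scope complex_scope.

(* Complex numbers are R[i] for a real field R : realType.  Derivatives are
   complex derivatives: R[i] is a numFieldType, hence a normed module over
   itself, and [derive1n j f] is the j-th complex derivative of f. *)

(* the field of complex numbers over R, seen as a numFieldType (so that it is
   canonically a normed module over itself, and derive1 is the complex
   derivative) *)
Definition CC (R : realType) : numFieldType := R[i].

Definition modc (R : realType) (z : CC R) : R := complex.Re `|z|.

Definition analytic_on_disc (R : realType) (f : CC R -> CC R) (c : CC R) (r : R)
  : Prop :=
  forall (k : nat) (z : CC R), modc (z - c) < r -> derivable (derive1n k f) z 1.

Definition Delta_basis (R : realType) (n : nat) (c : CC R)
  (F : nat -> CC R -> CC R) : Prop :=
  (exists2 r : R, 0 < r & forall i, (i <= n)%N -> analytic_on_disc (F i) c r) /\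
  exists P : nat -> {poly CC R},
    (forall j, (j <= n)%N -> size (P j) = j.+1) /\
    (forall i j, (i <= n)%N -> (j <= n)%N -> derive1n j (F i) c = (P j).[i%:R]).

Definition lincomb (R : realType) (n : nat) (a : nat -> CC R)
  (F : nat -> CC R -> CC R) : CC R -> CC R :=
  fun x => \sum_(i < n.+1) a i * F i x.

(* Main.v *)
Require Import Defs.
From HB Require Import structures.
From mathcomp Require Import all_boot all_order all_algebra.
From mathcomp Require Import complex.
From mathcomp Require Import all_classical all_reals all_analysis.
From mathcomp Require Import ring lra zify.
Import Order.TTheory GRing.Theory Num.Theory numFieldNormedType.Exports.
Set Implicit Arguments. Unset Strict Implicit. Unset Printing Implicit Defensive.
Local Open Scope ring_scope.

(** The vanishing of the first [mu] derivatives of [p] at [c] says that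
    [sum_i a_i Q(i) = 0] for every polynomial [Q] of degree [< mu] (this forces
    [mu <= n]).  For positive weights [w_i] with [w_0 = 1], let [K] be the
    reproducing kernel at [0] of the polynomials of degree [< mu] for the inner
    product [sum_i w_i f(i) g(i)], so that [sum_i w_i K(i)^2 = K(0)].  Then
    [a_0 = sum_i a_i (delta_0(i) - K(i))], and Cauchy-Schwarz gives
    [|a_0|^2 / (1 - K(0)) <= sum_i |a_i|^2 / w_i].  For [w = 1] the kernel comes from
    the discrete Chebyshev polynomials and [1 - K(0) = n!^2 / ((n-mu)! (n+mu)!)];
    for [w_i = 'C(n, i) q^i] it comes from the Krawtchouk polynomials.  The bound on
    the maximum uses [Q = K^2] with the Chebyshev kernel [K] of degree [< m], and the
    exponential bounds follow from [e^(2x) <= (1 + x) / (1 - x)]. *)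

(** * Finite moments and binomial identities *)

(** Both sides count the subsets of [{0, ..., n}] of size [k + l + 1]; the summand counts those
    whose element with exactly [k] smaller ones is [i]. The proof is an induction by Pascal's
    rule. *)
Lemma sum_bin_mul_rev (n k l : nat) :
  (\sum_(i < n.+1) 'C(i, k) * 'C(n - i, l) = 'C(n.+1, (k + l).+1))%N.
Proof.
elim: n l => [|n IHn] [|l].
- by rewrite big_ord1 bin0 muln1 addn0 binS bin0n addnC; case: k.
- by rewrite big_ord1 bin0n muln0 bin_small // addnS.
- rewrite big_ord_recr /= subnn bin0 muln1 addn0 binS; congr (_ + _)%N.
  by rewrite -[k in RHS]addn0 -IHn; apply: eq_bigr => i _; rewrite !bin0.
- rewrite big_ord_recr /= subnn bin0n muln0 addn0 binS -IHn addnS -IHn -big_split.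
  by apply: eq_bigr => i _ /=; rewrite subSn ?leq_ord // binS mulnDr.
Qed.

(** Since [P j] has degree exactly [j], these polynomials span all degrees below [M]: each induction
    step removes the top coefficient of [Q] by a multiple of the last one. *)
Lemma sum_horner_eq0 (F : fieldType) (N M : nat) (P : nat -> {poly F})
    (b x : 'I_N -> F) (Q : {poly F}) :
  (forall j, (j < M)%N -> size (P j) = j.+1) ->
  (forall j, (j < M)%N -> \sum_i b i * (P j).[x i] = 0) ->
  (size Q <= M)%N -> \sum_i b i * Q.[x i] = 0.
Proof.
move=> sP bP; elim: M Q sP bP => [|M IHM] Q sP bP sQ.
  move: sQ; rewrite leqn0 size_poly_eq0 => /eqP->.
  by rewrite big1 // => i _; rewrite horner0 mulr0.
have lP : (P M)`_M != 0.
  by have := sP M (ltnSn M) => sPM; rewrite -[M in _`_M]/(M.+1.-1) -sPM -lead_coefE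
     lead_coef_eq0 -size_poly_eq0 sPM.
set r := Q`_M / (P M)`_M.
have : \sum_i b i * (Q - r *: P M).[x i] = 0.
  apply: IHM => [j jM|j jM|]; [by apply/sP/ltnW|by apply/bP/ltnW|].
  apply/leq_sizeP => j; rewrite leq_eqVlt => /orP[/eqP<-|Mj].
    by rewrite coefB coefZ divfK // subrr.
  by rewrite coefB coefZ !nth_default ?mulr0 ?subr0 // ?sP // (leq_trans sQ).
move=> e; rewrite -[RHS](mulr0 r) -[X in r * X](bP M (ltnSn M)) mulr_sumr.
apply/eqP; rewrite -subr_eq0 -sumrB -[X in _ == X]e; apply/eqP.
by apply: eq_bigr => i _; rewrite hornerD hornerN hornerZ; ring.
Qed.

Definition bin_poly (F : fieldType) (k : nat) : {poly F} :=
  k`!%:R^-1 *: \prod_(t < k) ('X - t%:R%:P).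

Lemma prod_natr_sub_ffact (F : fieldType) (m k : nat) :
  \prod_(t < k) (m%:R - t%:R) = (m ^_ k)%:R :> F.
Proof.
elim: k => [|k IHk]; first by rewrite big_ord0 ffactn0.
rewrite big_ord_recr /= IHk ffactnSr natrM.
have [km|mk] := leqP k m; first by rewrite natrB.
by rewrite ffact_small // !mul0r.
Qed.

Lemma bin_poly_nat (F : numFieldType) (k m : nat) :
  (bin_poly F k).[m%:R] = 'C(m, k)%:R.
Proof.
rewrite hornerZ horner_prod.
under eq_bigr do rewrite !hornerE.
by rewrite prod_natr_sub_ffact -bin_ffact natrM mulrC mulfK // pnatr_eq0 -lt0n fact_gt0.
Qed.

Lemma size_bin_poly (F : numFieldType) (k : nat) : size (bin_poly F k) = k.+1.
Proof.
rewrite size_scale ?invr_eq0 ?pnatr_eq0 -?lt0n ?fact_gt0 //.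
by rewrite size_prod_XsubC -[index_enum _]enumT size_enum_ord.
Qed.

Lemma size_sub_monic (F : fieldType) (p q : {poly F}) (m : nat) :
  p \is monic -> q \is monic -> size p = m.+1 -> size q = m.+1 ->
  (size (p - q)%R <= m)%N.
Proof.
move=> /monicP; rewrite lead_coefE => lp /monicP; rewrite lead_coefE => lq sp sq.
apply/leq_sizeP => j; rewrite leq_eqVlt coefB => /orP[/eqP<-|mj].
  by move: lp lq; rewrite sp sq /= => -> ->; rewrite subrr.
by rewrite !nth_default ?subr0 ?sp ?sq.
Qed.

(** A Newton-type expansion. At [X = x] only the term [k = 0] survives, which fixes its coefficient;
    the remainder is divisible by [X - x], and the quotient is expanded recursively. *)
Lemma mixed_factorial_expansion (F : fieldType) (M : nat) (x s : F) (f : {poly F}) :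
  (forall t : nat, x + s + t%:R != 0) -> (size f <= M.+1)%N ->
  exists d : nat -> F, f = \sum_(k < M.+1) d k *:
    (\prod_(0 <= t < k) ((x - t%:R)%:P - 'X) *
     \prod_(k <= t < M) ('X + (s + t%:R)%:P)).
Proof.
elim: M x s f => [|M IHM] x s f xs sf.
  exists (fun=> f`_0); rewrite big_ord1 /= !big_geq // mulr1 alg_polyC.
  by apply: size1_polyC.
pose u := \prod_(0 <= t < M.+1) ('X + (s + t%:R)%:P).
have ux : u.[x] != 0.
  rewrite horner_prod prodf_seq_neq0; apply/allP => t _ /=.
  by rewrite hornerD hornerX hornerC addrA.
have su : size u = M.+2.
  rewrite /u big_mkord.
  have -> : \prod_(t < M.+1) ('X + (s + t%:R)%:P) =
      \prod_(t < M.+1) ('X - (- (s + t%:R))%:P).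
    by apply: eq_bigr => t _; rewrite polyCN opprK.
  by rewrite size_prod_XsubC -[index_enum _]enumT size_enum_ord.
set d0 := f.[x] / u.[x].
have : root (f - d0 *: u) x.
  by rewrite rootE !hornerE divfK // subrr.
move=> /factor_theorem[g fg].
(* The quotient is negated because the products use the factors [x - t - X]. *)
have sg : (size (- g)%R <= M.+1)%N.
  rewrite size_polyN; have [->|g0] := eqVneq g 0; first by rewrite size_poly0.
  have : (size (f - d0 *: u)%R <= M.+2)%N.
    rewrite (leq_trans (size_polyD _ _)) // geq_max sf size_polyN.
    by rewrite (leq_trans (size_scale_leq _ _)) // su.
  by rewrite fg size_mul ?polyXsubC_eq0 // size_XsubC addn2.
(* The shift to [x - 1] and [s + 1] preserves [x + s], hence the nonvanishing hypothesis. *)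
have [|d gd] := IHM (x - 1) (s + 1) (- g) _ sg.
  by move=> t; rewrite (_ : x - 1 + (s + 1) = x + s) //; ring.
exists (fun k => if k is k'.+1 then d k' else d0).
rewrite big_ord_recl; under [X in _ + X]eq_bigr => k _ do rewrite lift0.
rewrite /= [X in X * _]big_geq // mul1r -/u.
apply/eqP; rewrite addrC -subr_eq fg -[g]opprK gd mulNr -mulrN opprB.
rewrite mulr_suml; apply/eqP; apply: eq_bigr => k _.
rewrite -scalerAl; congr (_ *: _).
rewrite big_nat_recl // subr0 big_add1 /= mulrC mulrA; congr (_ * _ * _).
  by apply: eq_bigr => t _; rewrite -natr1; congr (_%:P - _); ring.
by apply: eq_bigr => t _; rewrite -natr1; congr (_ + _%:P); ring.
Qed.

(** * The discrete Chebyshev kernel *)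

Lemma prod_addn_ffact (l s k M : nat) : (k <= M)%N ->
  (\prod_(k <= t < M) (l + (s.+1 + t)) = (l + s + M) ^_ (M - k))%N.
Proof.
move=> kM; rewrite -(subnKC kM); elim: (M - k)%N => [|j IHj].
  by rewrite addn0 subnn big_geq // ffactn0.
rewrite addnS big_nat_recr ?leq_addr //= IHj addKn (addnS (l + s)%N) -(addnS k) addKn.
rewrite ffactSS mulnC.
by congr (_ * _ ^_ _)%N; lia.
Qed.

Lemma ffactnD (n l k : nat) : (n ^_ (l + k) = n ^_ l * (n - l) ^_ k)%N.
Proof.
elim: k => [|k IHk]; first by rewrite addn0 ffactn0 muln1.
by rewrite addnS !ffactnSr IHk -mulnA subnDA.
Qed.

Lemma bin_ffact_split (n M k l : nat) : (l <= n)%N -> (k < M)%N ->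
  ('C(n.+1, (k + l).+1) * ((l + M)`! * (n - l)`!) =
   n.+1`! * ((n - l) ^_ k * (l + M) ^_ (M.-1 - k)))%N.
Proof.
move=> ln kM.
rewrite -[in LHS](@ffact_fact (l + M) (M.-1 - k)) ?leq_subLR; last by lia.
have -> : (l + M - (M.-1 - k) = (k + l).+1)%N by lia.
rewrite -(@ffact_fact n.+1 l.+1) // subSS.
have := bin_ffact n.+1 (k + l).+1.
have -> : (n.+1 ^_ (k + l).+1 = n.+1 ^_ l.+1 * (n - l) ^_ k)%N.
  by rewrite -addnS addnC ffactnD subSS.
move=> e; rewrite -mulnA mulnCA (mulnA 'C(_, _)) e; ring.
Qed.

(* By [sum_bin_mul_rev], the [d k] are the coefficients of the kernel in the basis
   ['C(x, k)], tested against ['C(n - x, l)].  Clearing denominators, the system says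
   that [sum_k d_k prod_(t < k) (n - t - X) prod_(k <= t < mu - 1) (X + 2 + t)] and
   [(prod_(t < mu) (X + 1 + t) - prod_(t < mu) (X - t)) / (n + 1)], both of degree
   [< mu], agree at [0, ..., mu - 1]; evaluation at [n] then gives [d 0]. *)
Lemma chebyshev_kernel_coef (F : numFieldType) (n mu : nat) : (mu <= n)%N -> (0 < mu)%N ->
  exists d : nat -> F,
    (forall l, (l < mu)%N ->
      \sum_(k < mu) d k * 'C(n.+1, (k + l).+1)%:R = 'C(n, l)%:R) /\
    1 - d 0%N = n`!%:R ^+ 2 / ((n - mu)`!%:R * (n + mu)`!%:R).
Proof.
case: mu => // M Mn _.
pose p := \prod_(t < M.+1) ('X - (- (1 + t%:R))%:P) : {poly F}.
pose q := \prod_(t < M.+1) ('X - t%:R%:P) : {poly F}.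
have sz (h : 'I_M.+1 -> F) : size (\prod_t ('X - (h t)%:P)) = M.+2.
  by rewrite size_prod_XsubC -[index_enum _]enumT size_enum_ord.
have spq : (size (n.+1%:R^-1 *: (p - q)) <= M.+1)%N.
  rewrite (leq_trans (size_scale_leq _ _)) //.
  by apply: size_sub_monic; rewrite ?monic_prod_XsubC ?sz.
have [|d dE] := @mixed_factorial_expansion F M n%:R 2 _ _ spq.
  by move=> t; rewrite -!natrD pnatr_eq0; lia.
have evp (x : nat) : p.[x%:R] = ((x + M.+1) ^_ M.+1)%:R.
  have := prod_addn_ffact x 0 (leq0n M.+1); rewrite addn0 subn0 => <-.
  rewrite horner_prod big_mkord natr_prod; apply: eq_bigr => t _.
  by rewrite hornerXsubC opprK !natrD.
have evq (x : nat) : q.[x%:R] = (x ^_ M.+1)%:R.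
  rewrite horner_prod -prod_natr_sub_ffact; apply: eq_bigr => t _.
  by rewrite hornerXsubC.
have evu (x k : nat) : (x <= n)%N -> (k <= M)%N ->
    (\prod_(0 <= t < k) ((n%:R - t%:R)%:P - 'X) *
     \prod_(k <= t < M) ('X + (2 + t%:R)%:P)).[x%:R] =
    ((n - x) ^_ k * (x + M.+1) ^_ (M - k))%:R :> F.
  move=> xn kM; rewrite hornerM natrM !horner_prod; congr (_ * _).
    rewrite -prod_natr_sub_ffact big_mkord; apply: eq_bigr => t _.
    by rewrite hornerD hornerC hornerN hornerX natrB //; ring.
  have := prod_addn_ffact x 1 kM; rewrite addn1 addSnnS => <-.
  rewrite natr_prod; apply: eq_bigr => t _.
  by rewrite hornerD hornerX hornerC !natrD.
have n1 : n.+1%:R != 0 :> F by rewrite pnatr_eq0.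
have fact_neq0 x : x`!%:R != 0 :> F by rewrite pnatr_eq0 -lt0n fact_gt0.
exists d; split.
  move=> l lM; have ln : (l <= n)%N by lia.
  have /(congr1 (fun r : {poly F} => r.[l%:R])) := dE.
  (* For [l < mu] the node [l] is a root of [q], so only the rising product [p] contributes. *)
  rewrite hornerZ hornerD hornerN evp evq (ffact_small lM) subr0 horner_sum.
  under eq_bigr => k _ do rewrite hornerZ evu ?leq_ord //.
  move=> e.
  have c0 : ((l + M.+1)`! * (n - l)`!)%:R != 0 :> F by rewrite natrM mulf_neq0.
  apply: (mulIf c0); rewrite mulr_suml.
  transitivity (n.+1`!%:R * \sum_(i < M.+1) d i * ((n - l) ^_ i * (l + M.+1) ^_ (M - i))%:R).
    rewrite mulr_sumr; apply: eq_bigr => k _.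
    rewrite -mulrA -natrM bin_ffact_split // natrM; ring.
  rewrite -e factS natrM mulrACA mulfV // mul1r -!natrM; congr _%:R.
  rewrite -(@ffact_fact (l + M.+1) M.+1) ?leq_addl // addnK.
  by rewrite -(bin_fact ln); ring.
have /(congr1 (fun r : {poly F} => r.[n%:R])) := dE.
rewrite hornerZ hornerD hornerN evp evq horner_sum.
under eq_bigr => k _ do rewrite hornerZ evu ?leq_ord //.
rewrite big_ord_recl big1 ?addr0; last first.
  by move=> k _; rewrite subnn /= ffact_small // mul0n mulr0.
rewrite /= ffactn0 mul1n subn0 => e.
(* The factor [n + 1] of the full falling factorial cancels the normalisation, so [1 - d 0] is the
   ratio of [n ^_ mu] to [(n + mu) ^_ mu]. *)
have e' : d 0%N * ((n + M.+1) ^_ M.+1)%:R = ((n + M.+1) ^_ M.+1)%:R - (n ^_ M.+1)%:R.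
  have fS : ((n + M.+1) ^_ M.+1 = (n + M.+1) ^_ M * n.+1)%N.
    by rewrite ffactnSr; congr (_ * _)%N; lia.
  by rewrite {1}fS natrM mulrA -e mulrAC mulVf // mul1r.
have f1 : (n + M.+1)`!%:R = ((n + M.+1) ^_ M.+1)%:R * n`!%:R :> F.
  by rewrite -natrM -(@ffact_fact (n + M.+1) M.+1) ?leq_addl // addnK.
have f2 : n`!%:R = (n ^_ M.+1)%:R * (n - M.+1)`!%:R :> F.
  by rewrite -natrM ffact_fact.
have g1 := fact_neq0 (n + M.+1)%N; have g2 := fact_neq0 (n - M.+1)%N.
apply: (mulIf (mulf_neq0 g2 g1)); rewrite divfK ?mulf_neq0 //.
rewrite f1 expr2 {2}f2.
transitivity ((((n + M.+1) ^_ M.+1)%:R - d 0%N * ((n + M.+1) ^_ M.+1)%:R) * ((n - M.+1)`!%:R * n`!%:R)); first by ring.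
by rewrite e'; ring.
Qed.

(** On [{0, ..., n}], [K] minus the indicator of [0] is orthogonal to every ['C(n - x, l)] with
    [l < mu]. These span the polynomials of degree below [mu], so it is orthogonal to [K] itself,
    which is the second claim. *)
Lemma chebyshev_kernel (F : numFieldType) (n mu : nat) : (mu <= n)%N -> (0 < mu)%N ->
  exists K : {poly F},
    [/\ (size K <= mu)%N, \sum_(i < n.+1) K.[i%:R] ^+ 2 = K.[0] &
      1 - K.[0] = n`!%:R ^+ 2 / ((n - mu)`!%:R * (n + mu)`!%:R)].
Proof.
move=> mun mu0; have [d [dC d0]] := @chebyshev_kernel_coef F n mu mun mu0.
pose K := \sum_(k < mu) d k *: bin_poly F k.
have sK : (size K <= mu)%N.
  rewrite (leq_trans (size_sum _ _ _)) //; apply/bigmax_leqP => k _.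
  by rewrite (leq_trans (size_scale_leq _ _)) // size_bin_poly.
have K_nat (i : nat) : K.[i%:R] = \sum_(k < mu) d k * 'C(i, k)%:R.
  by rewrite horner_sum; apply: eq_bigr => k _; rewrite hornerZ bin_poly_nat.
have K0 : K.[0] = d 0%N.
  rewrite -[X in K.[X]]/(0%:R) K_nat; case: (mu) mu0 => // M _.
  by rewrite big_ord_recl bin0 mulr1 big1 ?addr0 // => k _; rewrite bin0n mulr0.
exists K; split; rewrite ?K0 //.
pose b (i : 'I_n.+1) := K.[i%:R] - (i == 0%N :> nat)%:R.
pose P l : {poly F} := bin_poly F l \Po (n%:R%:P - 'X).
have sP l : size (P l) = l.+1.
  rewrite size_comp_poly2 ?size_bin_poly //.
  by rewrite -size_polyN opprB size_XsubC.
have Pi l (i : 'I_n.+1) : (P l).[i%:R] = 'C(n - i, l)%:R.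
  by rewrite horner_comp hornerD hornerC hornerN hornerX -natrB ?leq_ord // bin_poly_nat.
have delta (f : nat -> F) : \sum_(i < n.+1) (i == 0%N :> nat)%:R * f i = f 0%N.
  by rewrite big_ord_recl /= mul1r big1 ?addr0 // => i _; rewrite mul0r.
have bP j : (j < mu)%N -> \sum_i b i * (P j).[i%:R] = 0.
  move=> jmu; under eq_bigr => i _ do rewrite mulrBl Pi K_nat mulr_suml.
  rewrite sumrB (delta (fun i => 'C(n - i, j)%:R)) subn0 exchange_big /=.
  rewrite -(dC j jmu); apply/eqP; rewrite subr_eq0; apply/eqP; apply: eq_bigr => k _.
  rewrite -sum_bin_mul_rev natr_sum mulr_sumr; apply: eq_bigr => i _.
  by rewrite natrM mulrA.
have e := sum_horner_eq0 (fun j _ => sP j) bP sK.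
have : \sum_(i < n.+1) b i * K.[i%:R] = \sum_(i < n.+1) K.[i%:R] ^+ 2 - K.[0].
  rewrite -(delta (fun i => K.[i%:R])) -sumrB; apply: eq_bigr => i _.
  by rewrite mulrBl expr2.
by rewrite e K0 => /esym/eqP; rewrite subr_eq0 => /eqP.
Qed.

(** * The Krawtchouk kernel *)

(* The generating polynomial, in the degree [j], of the values at [i] of the
   Krawtchouk polynomials, scaled to take the value ['C(n, j) q^j] at [i = 0]. *)
Definition krawtchouk_gen (F : fieldType) (q : F) (n i : nat) : {poly F} :=
  (1 + q *: 'X) ^+ (n - i) * (1 - 'X) ^+ i.

Lemma coef_exp1DZX (F : fieldType) (c : F) (n j : nat) :
  ((1 + c *: 'X) ^+ n)`_j = 'C(n, j)%:R * c ^+ j.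
Proof.
rewrite exprDn coef_sum.
under eq_bigr => k _ do
  rewrite expr1n mul1r exprZn -scaler_nat scalerA coefZ coefXn eq_sym.
have [jn|nj] := leqP j n.
  rewrite (bigD1 (Ordinal (jn : j < n.+1)%N)) //= eqxx mulr1 big1 ?addr0 // => k kj.
  by rewrite (_ : (k == j :> nat) = false) ?mulr0 //; apply/negbTE.
rewrite bin_small // mul0r big1 // => k _.
by rewrite (_ : (k == j :> nat) = false) ?mulr0 //; have := ltn_ord k; lia.
Qed.

(** Writing [1 - X = (1 + q X) - (1 + q) X] and expanding the [i]-th power makes the [j]-th
    coefficient a combination of ['C(i, l)] with [l <= j], hence polynomial in [i]. *)
Lemma krawtchouk_poly (F : numFieldType) (q : F) (n j : nat) :
  exists2 k : {poly F}, (size k <= j.+1)%N &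
    forall i, (i <= n)%N -> k.[i%:R] = (krawtchouk_gen q n i)`_j.
Proof.
exists (\sum_(l < j.+1) ((- (1 + q)) ^+ l * ('C(n - l, j - l)%:R * q ^+ (j - l)))
         *: bin_poly F l).
  rewrite (leq_trans (size_sum _ _ _)) //; apply/bigmax_leqP => k _.
  by rewrite (leq_trans (size_scale_leq _ _)) // size_bin_poly ltn_ord.
move=> i ni; rewrite horner_sum /krawtchouk_gen.
have -> : (1 - 'X : {poly F}) = (1 + q *: 'X) + (- (1 + q)) *: 'X.
  by rewrite scaleNr scalerDl scale1r opprD addrACA subrr addr0 addrC.
rewrite (exprDn _ _ i) mulr_sumr coef_sum.
(* The conditional is needed because [j - l] truncates to [0] for [l > j]. As [c l] vanishes for
   [l > i] too, the sums up to [i] and up to [j] agree. *)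
pose c l : F := 'C(i, l)%:R * ((- (1 + q)) ^+ l *
   (if (l <= j)%N then 'C(n - l, j - l)%:R * q ^+ (j - l) else 0)).
transitivity (\sum_(l < i.+1) c l); last first.
  apply: eq_bigr => l _.
  rewrite mulrnAr mulrA -exprD.
  have -> : (n - i + (i - l) = n - l)%N by have := ltn_ord l; lia.
  rewrite exprZn -scaler_nat -scalerAr scalerA coefZ coefMXn coef_exp1DZX /c.
  by rewrite ltnNge; case: (leqP l j) => lj; rewrite /= ?mulr0 //; ring.
transitivity (\sum_(l < j.+1) c l).
  apply: eq_bigr => l _; rewrite hornerZ bin_poly_nat /c leq_ord; ring.
have ext a b : (a <= b)%N -> (forall l, (a <= l < b)%N -> c l = 0) ->
    \sum_(l < b) c l = \sum_(l < a) c l.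
  move=> ab c0; rewrite -!(big_mkord xpredT c) (big_cat_nat (n := a)) //=.
  by rewrite [X in _ + X]big_nat_cond [X in _ + X]big1 ?addr0 // => l /andP[/c0].
have [ji|ij] := leqP j i.
  by rewrite (ext j.+1 i.+1) // => l /andP[jl _]; rewrite /c leqNgt jl !mulr0.
by rewrite (ext i.+1 j.+1) 1?ltnW // => l /andP[il _]; rewrite /c bin_small ?mul0r.
Qed.

(* Both sides are coefficients of the bivariate identity
   [(1 + q t) (1 + q s) + q (1 - t) (1 - s) = (1 + q) (1 + q s t)], raised to [n]. *)
Lemma krawtchouk_orthogonal (F : fieldType) (q : F) (n j l : nat) :
  \sum_(i < n.+1) 'C(n, i)%:R * q ^+ i *
     ((krawtchouk_gen q n i)`_j * (krawtchouk_gen q n i)`_l) =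
  (j == l)%:R * ((1 + q) ^+ n * ('C(n, j)%:R * q ^+ j)).
Proof.
pose g i := krawtchouk_gen q n i.
(* The outer variable is [t] and the inner one is [s], so [G]_j[_l] is the coefficient of
   [t^j s^l]. *)
pose G : {poly {poly F}} := \sum_(i < n.+1)
  ('C(n, i)%:R * q ^+ i)%:P%:P * ((g i)^:P * (g i)%:P).
have -> : \sum_(i < n.+1) 'C(n, i)%:R * q ^+ i * ((g i)`_j * (g i)`_l) = G`_j`_l.
  rewrite !coef_sum; apply: eq_bigr => i _.
  by rewrite coefCM coefMC coef_map /= !coefCM.
suff -> : G = ((1 + q) ^+ n)%:P%:P * \sum_(i < n.+1) (('C(n, i)%:R * q ^+ i) *: 'X^i)%:P * 'X^i.
  rewrite coefCM coefCM coef_sum.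
  under eq_bigr => i _ do rewrite coefCM coefXn.
  rewrite coef_sum.
  under eq_bigr => i _ do rewrite mulr_natr coefMn coefZ coefXn -mulrnAr.
  have [jn|nj] := leqP j n; last first.
    rewrite bin_small // big1 ?mul0r ?mulr0 // => i _.
    by rewrite (_ : (j == i :> nat) = false) ?mulr0n ?mulr0 //; have := ltn_ord i; lia.
  rewrite (bigD1 (Ordinal (jn : j < n.+1)%N)) //= eqxx mulr1n big1 ?addr0.
    by rewrite eq_sym; ring.
  move=> i ij; rewrite (_ : (j == i :> nat) = false) ?mulr0n ?mulr0 //.
  by apply/negbTE; rewrite eq_sym.
pose s : {poly {poly F}} := 'X%:P.
pose Q : {poly {poly F}} := q%:P%:P.
have gE i : (g i)%:P = (1 + Q * s) ^+ (n - i) * (1 - s) ^+ i.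
  rewrite /g /krawtchouk_gen rmorphM !rmorphXn rmorphD rmorphB rmorph1 /=.
  by rewrite -mul_polyC rmorphM.
have gE' i : (g i)^:P = (1 + Q * 'X) ^+ (n - i) * (1 - 'X) ^+ i.
  rewrite /g /krawtchouk_gen rmorphM !rmorphXn rmorphD rmorphB rmorph1 /=.
  by rewrite -mul_polyC rmorphM /= map_polyC map_polyX.
transitivity (((1 + Q * 'X) * (1 + Q * s) + Q * (1 - 'X) * (1 - s)) ^+ n).
  rewrite exprDn; apply: eq_bigr => i _.
  rewrite gE gE' -[RHS]mulr_natl !exprMn polyCM polyCM !polyC_natr !polyC_exp -/Q; ring.
have -> : (1 + Q * 'X) * (1 + Q * s) + Q * (1 - 'X) * (1 - s) =
   (1 + Q) * (1 + (Q * s) * 'X) by ring.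
rewrite exprMn; congr (_ * _).
  by rewrite !polyC_exp !polyCD polyC1.
rewrite exprDn; apply: eq_bigr => i _.
rewrite expr1n mul1r -[LHS]mulr_natl !exprMn -mul_polyC !polyCM !polyC_natr !polyC_exp mulrA.
by rewrite -/Q -/s mulrA.
Qed.

(** The value at [0] of the [j]-th Krawtchouk polynomial is [(1 + q)^-n] times its squared norm. All
    of them thus enter the kernel at [0] with the same coefficient, and [K] is a multiple of their
    plain sum. *)
Lemma krawtchouk_kernel (F : numFieldType) (q : F) (n mu : nat) : 1 + q != 0 ->
  exists K : {poly F},
    [/\ (size K <= mu)%N,
      \sum_(i < n.+1) 'C(n, i)%:R * q ^+ i * K.[i%:R] ^+ 2 = K.[0] &
      K.[0] = (1 + q) ^- n * \sum_(j < mu) 'C(n, j)%:R * q ^+ j].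
Proof.
move=> q1; have /fin_all_exists[k kP] (j : 'I_mu) : exists k : {poly F},
    (size k <= j.+1)%N /\
    forall i, (i <= n)%N -> k.[i%:R] = (krawtchouk_gen q n i)`_j.
  by have [k ? ?] := krawtchouk_poly q n j; exists k.
pose K := (1 + q) ^- n *: \sum_j k j.
have Ki i : (i <= n)%N ->
    K.[i%:R] = (1 + q) ^- n * \sum_(j < mu) (krawtchouk_gen q n i)`_j.
  move=> ni; rewrite hornerZ horner_sum; congr (_ * _).
  by apply: eq_bigr => j _; rewrite (kP j).2.
have K0 : K.[0] = (1 + q) ^- n * \sum_(j < mu) 'C(n, j)%:R * q ^+ j.
  rewrite -[X in K.[X]]/(0%:R) Ki //; congr (_ * _); apply: eq_bigr => j _.
  by rewrite /krawtchouk_gen subn0 expr0 mulr1 coef_exp1DZX.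
exists K; split => //.
  rewrite (leq_trans (size_scale_leq _ _)) // (leq_trans (size_sum _ _ _)) //.
  by apply/bigmax_leqP => j _; rewrite (leq_trans (kP j).1).
rewrite K0.
pose S i := \sum_(j < mu) (krawtchouk_gen q n i)`_j.
transitivity ((1 + q) ^- n * ((1 + q) ^- n *
    \sum_(i < n.+1) 'C(n, i)%:R * q ^+ i * (S i * S i))).
  rewrite mulrA mulr_sumr; apply: eq_bigr => i _.
  by rewrite Ki ?leq_ord // -/(S i); ring.
congr (_ * _).
transitivity ((1 + q) ^- n * \sum_(j < mu) \sum_(l < mu)
    (j == l)%:R * ((1 + q) ^+ n * ('C(n, j)%:R * q ^+ j))).
  congr (_ * _).
  under [RHS]eq_bigr => j _ do under eq_bigr => l _ do rewrite -krawtchouk_orthogonal.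
  under [RHS]eq_bigr => j _ do rewrite exchange_big /=.
  rewrite [RHS]exchange_big /=; apply: eq_bigr => i _.
  rewrite /S mulr_suml mulr_sumr; apply: eq_bigr => j _.
  by rewrite !mulr_sumr.
rewrite mulr_sumr; apply: eq_bigr => j _.
rewrite (bigD1 j) //= eqxx mul1r big1 ?addr0 ?mulKf ?expf_neq0 // => l lj.
by rewrite eq_sym (negbTE lj) mul0r.
Qed.

(** * Exponential lower bounds *)

(** The difference [f] of the two sides vanishes at [0], and [f' = 1 - (1 - 2y) e^(2y)] is
    nonnegative because [1 - 2y <= e^(-2y)]. *)
Lemma expR_le_cayley (R : realType) (x : R) : 0 <= x -> expR (2 * x) * (1 - x) <= 1 + x.
Proof.
move=> x0; pose f y : R := 1 + y - expR (2 * y) * (1 - y).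
have df (y : R) : is_derive y 1 f (1 - (1 - 2 * y) * expR (2 * y)).
  have -> : f = (cst 1 + id) - (expR \o (fun z => 2 * z)) * (cst 1 - id) by [].
  by apply: is_derive_eq; rewrite /= /GRing.scale /= -[(cst 1 - id) y]/(1 - y); ring.
suff : f 0 <= f x by rewrite /f mulr0 expR0 subr0 mul1r addr0 subrr subr_ge0.
apply: (@ger0_derive1_ndecry R f 0) => // [y _|].
  rewrite derive1E derive_val.
  have e1 := expR_ge1Dx (- (2 * y)); have e2 := expR_gt0 (2 * y).
  have e3 : expR (- (2 * y)) * expR (2 * y) = 1 by rewrite -expRD addNr expR0.
  rewrite -{1}e3 -mulrBl mulr_ge0 ?(ltW e2) //; lra.
apply: continuous_subspaceT => y.
by apply/differentiable_continuous/derivable1_diffP; case: (df y).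
Qed.

(** From [m] to [m + 1] the ratio gains the factor [(n + m + 1) / (n - m) = (1 + x) / (1 - x)] with
    [x = (2m + 1) / (2n + 1)], while the exponent grows by [2x]. *)
Lemma expR_le_fact_ratio (R : realType) (n m : nat) : (m <= n)%N ->
  expR (2 * m%:R ^+ 2 / (2 * n%:R + 1)) <=
    (n - m)`!%:R * (n + m)`!%:R / (n`!%:R ^+ 2) :> R.
Proof.
elim: m => [|m IHm] mn.
  rewrite expr0n /= mulr0 mul0r expR0 subn0 addn0 -expr2 divff // expf_neq0 //.
have {}IHm := IHm (ltnW mn).
pose N : R := 2 * n%:R + 1; pose x : R := (2 * m%:R + 1) / N.
have N0 : 0 < N by rewrite /N ltr_wpDl ?mulr_ge0.
have nm : (m.+1%:R : R) <= n%:R by rewrite ler_nat.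
have x0 : 0 <= x by rewrite divr_ge0 ?ltW // ltr_wpDl ?mulr_ge0.
have x1 : 0 < 1 - x.
  rewrite subr_gt0 ltr_pdivrMr // mul1r /N.
  by move: nm; rewrite -natr1; lra.
have step : expR (2 * x) <= (n%:R + m.+1%:R) / (n%:R - m%:R).
  have nm0 : 0 < n%:R - m%:R :> R by move: nm; rewrite -natr1; lra.
  have := @expR_le_cayley R x x0.
  rewrite -ler_pdivlMr // => /le_trans; apply.
  rewrite le_eqVlt; apply/orP; left; apply/eqP.
  have -> : 1 + x = 2 * (n%:R + m.+1%:R) / N.
    by rewrite /x -natr1 -[X in X + _](divff (lt0r_neq0 N0)) -mulrDl; congr (_ / _); rewrite /N; ring.
  have -> : 1 - x = 2 * (n%:R - m%:R) / N.
    by rewrite /x -[X in X - _](divff (lt0r_neq0 N0)) -mulrBl; congr (_ / _); rewrite /N; ring.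
  field; rewrite !lt0r_neq0 //.
have -> : 2 * m.+1%:R ^+ 2 / (2 * n%:R + 1) = 2 * m%:R ^+ 2 / (2 * n%:R + 1) + 2 * x.
  by rewrite /x -/N -natr1; field; rewrite lt0r_neq0.
rewrite expRD.
have -> : (n - m.+1)`!%:R * (n + m.+1)`!%:R / n`!%:R ^+ 2 =
    (n - m)`!%:R * (n + m)`!%:R / n`!%:R ^+ 2 * ((n%:R + m.+1%:R) / (n%:R - m%:R)) :> R.
  have -> : ((n - m)`! = (n - m.+1)`! * (n - m))%N.
    by have e : (n - m = (n - m.+1).+1)%N; [lia | rewrite {1}e factS -e mulnC].
  rewrite addnS factS !natrM -natrD addnS -(natrB _ (ltnW mn)).
  have nm0 : (n - m)%:R != 0 :> R by rewrite pnatr_eq0 -lt0n subn_gt0.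
  have shuffle (u v w x' y : R) : y != 0 -> u * (x' * v) / w = u * y * v / w * (x' / y).
    by move=> y0; rewrite -[in LHS](mulfK y0 u); ring.
  exact: shuffle.
by apply: ler_pM => //; apply: expR_ge0.
Qed.

(** * Complex coefficients *)

Local Open Scope complex_scope.

Lemma modcE (R : realType) (z : CC R) : `|z| = (modc z)%:C :> R[i].
Proof. by rewrite /modc [`|z|]normc_def. Qed.

Lemma modc_ge0 (R : realType) (z : CC R) : 0 <= modc z.
Proof. by rewrite -lecR -modcE normr_ge0. Qed.

Lemma modcM (R : realType) (x y : CC R) : modc (x * y) = modc x * modc y.
Proof. by apply: (@complexI R); rewrite rmorphM /= -!modcE normrM. Qed.

Lemma modc_real (R : realType) (x : R) : modc (x%:C : CC R) = `|x|.
Proof. by apply: (@complexI R); rewrite -modcE normc_def /= expr0n addr0 sqrtr_sqr. Qed.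

Lemma ler_modcD (R : realType) (x y : CC R) : modc (x + y) <= modc x + modc y.
Proof. by rewrite -lecR rmorphD /= -!modcE ler_normD. Qed.

Lemma ler_modc_sum (R : realType) (I : finType) (P : pred I) (f : I -> CC R) :
  modc (\sum_(i | P i) f i) <= \sum_(i | P i) modc (f i).
Proof.
elim/big_ind2: _ => // [|x1 x2 y1 y2 le1 le2].
  by rewrite -[0 : CC R]/(0%:C) modc_real normr0.
by rewrite (le_trans (ler_modcD _ _)) // lerD.
Qed.

(** * Vanishing derivatives and vanishing moments *)

(** Stated on the whole disc rather than at [c] alone, since the induction differentiates the
    identity and needs it near [z]. *)
Lemma derive1n_lincomb (R : realType) (n : nat) (c : CC R) (F : nat -> CC R -> CC R)
    (a : nat -> CC R) (r : R) (k : nat) (z : CC R) :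
  (forall i, (i <= n)%N -> analytic_on_disc (F i) c r) -> modc (z - c) < r ->
  derive1n k (lincomb n a F) z = \sum_(i < n.+1) a i * derive1n k (F i) z.
Proof.
move=> aF; elim: k z => [|k IHk] z zr; first by [].
rewrite derive1nS derive1E.
pose g i := (fun x => a i * derive1n k (F i) x) : CC R -> CC R.
have dg (i : 'I_n.+1) : is_derive z 1 (g i) (a i * derive1n k.+1 (F i) z).
  have dF : derivable (derive1n k (F i)) z 1 by apply: aF; rewrite ?leq_ord.
  rewrite derive1nS derive1E.
  apply: is_deriveZ; exact/derivableP.
rewrite (@near_eq_derive _ _ _ _ (\sum_(i < n.+1) g i)) /=.
  by have d := is_derive_sum dg; rewrite derive_val.
have r0 : 0 < (r - modc (z - c))%:C :> CC R by rewrite ltcR subr_gt0.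
apply: filterS (nbhsx_ballx z _ r0) => w; rewrite -ball_normE /= => zw.
rewrite IHk; first by rewrite fct_sumE.
have : `|w - c| < (r%:C : R[i]).
  rewrite (_ : w - c = (z - c) - (z - w)); last by ring.
  apply: (le_lt_trans (ler_normB _ _)).
  by move: zw; rewrite rmorphB /= -modcE ltrBrDl.
by rewrite modcE ltcR.
Qed.

(** The [j]-th derivative at [c] is the sum of the [a i * (P j).[i]]. The bound on [M] keeps
    [j <= n], where the basis property gives [P j]. *)
Lemma Delta_basis_moment_eq0 (R : realType) (n : nat) (c : CC R)
    (F : nat -> CC R -> CC R) (a : nat -> CC R) (M : nat) (Q : {poly CC R}) :
  Delta_basis n c F -> (M <= n.+1)%N ->
  (forall j, (j < M)%N -> derive1n j (lincomb n a F) c = 0) ->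
  (size Q <= M)%N -> \sum_(i < n.+1) a i * Q.[i%:R] = 0.
Proof.
move=> [[r r0 aF] [P [sP PF]]] Mn dp.
apply: (@sum_horner_eq0 _ _ _ P) => j jM; first by apply: sP; lia.
rewrite -[RHS](dp j jM) (@derive1n_lincomb _ _ c _ _ r _ c) //; last first.
  by rewrite subrr -[0 : CC R]/(0%:C) modc_real normr0.
by apply: eq_bigr => i _; rewrite PF ?leq_ord //; lia.
Qed.

(** Otherwise all moments of degree at most [n] vanish; testing with [(X - 1) ... (X - n)], which
    kills every index but [0], would force [a 0 = 0]. *)
Lemma Delta_basis_multiplicity_le (R : realType) (n : nat) (c : CC R)
    (F : nat -> CC R -> CC R) (a : nat -> CC R) (mu : nat) :
  Delta_basis n c F -> a 0%N != 0 ->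
  (forall j, (j < mu)%N -> derive1n j (lincomb n a F) c = 0) -> (mu <= n)%N.
Proof.
move=> DF a0 dp; rewrite leqNgt; apply/negP => nmu.
pose Q : {poly CC R} := \prod_(t < n) ('X - t.+1%:R%:P).
have sQ : (size Q <= n.+1)%N.
  by rewrite size_prod_XsubC -[index_enum _]enumT size_enum_ord.
have := @Delta_basis_moment_eq0 R n c F a n.+1 Q DF (leqnn _) _ sQ.
move=> /(_ (fun j jn => dp j (leq_trans jn nmu))).
rewrite big_ord_recl big1 ?addr0 => [|i _]; last first.
  rewrite horner_prod (bigD1 i) //= hornerXsubC /bump /= add1n.
  by rewrite subrr mul0r mulr0.
move/eqP; rewrite mulf_eq0 (negbTE a0) horner_prod /= prodf_seq_eq0.
by move=> /hasP[t _]; rewrite /= hornerXsubC sub0r oppr_eq0 pnatr_eq0.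
Qed.

Lemma real_moment_eq0 (R : realType) (n : nat) (a : nat -> CC R) (M : nat) :
  (forall Q : {poly CC R}, (size Q <= M)%N -> \sum_(i < n.+1) a i * Q.[i%:R] = 0) ->
  forall K : {poly R}, (size K <= M)%N -> \sum_(i < n.+1) a i * (K.[i%:R])%:C = 0.
Proof.
move=> aQ K sK; rewrite -[RHS](aQ (map_poly (real_complex R) K : {poly CC R})); last first.
  by rewrite size_map_poly.
apply: eq_bigr => i _; congr (_ * _).
have -> : (i%:R : CC R) = (i%:R : R)%:C by rewrite rmorph_nat.
by rewrite (horner_map (real_complex R)).
Qed.

(** * Bounds on the coefficients from a kernel *)

Lemma kernel_l2_bound (R : realType) (n : nat) (a : nat -> CC R) (w K : nat -> R) :
  (forall i, (i <= n)%N -> 0 < w i) -> w 0%N = 1 ->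
  \sum_(i < n.+1) w i * K i ^+ 2 = K 0%N -> K 0%N < 1 ->
  \sum_(i < n.+1) a i * (K i)%:C = 0 ->
  modc (a 0%N) ^+ 2 / (1 - K 0%N) <= \sum_(i < n.+1) modc (a i) ^+ 2 / w i.
Proof.
move=> w_gt0 w0 K2 K1 aK.
pose y (i : 'I_n.+1) := (i == 0%N :> nat)%:R - K i.
have y2 : \sum_(i < n.+1) w i * y i ^+ 2 = 1 - K 0%N.
  rewrite !big_ord_recl /= /y /= w0.
  under eq_bigr => i _ do rewrite sub0r sqrrN.
  by move: K2; rewrite big_ord_recl /= w0; set S := \sum_(i < n) _ => K2; lra.
have a0 : a 0%N = \sum_(i < n.+1) a i * (y i)%:C.
  transitivity (\sum_(i < n.+1) (a i * (i == 0%N :> nat)%:R - a i * (K i)%:C)).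
    rewrite sumrB aK subr0 big_ord_recl /= mulr1 big1 ?addr0 // => i _.
    by rewrite mulr0.
  apply: eq_bigr => i _; rewrite /y rmorphB /= mulrBr; congr (_ * _ - _).
  by case: (_ == _).
have a0_le : modc (a 0%N) <= \sum_(i < n.+1) modc (a i) * `|y i|.
  rewrite {1}a0 (le_trans (ler_modc_sum _ _)) // ler_sum // => i _.
  by rewrite modcM modc_real.
(* Cauchy-Schwarz is obtained from a nonnegative sum of squares; [t = X / B] minimises
   [t^2 B - 2 t X], with minimum [- X^2 / B]. *)
pose B := 1 - K 0%N; pose X := modc (a 0%N); pose t := X / B.
have B0 : 0 < B by rewrite subr_gt0.
have t0 : 0 <= t by rewrite divr_ge0 ?modc_ge0 ?ltW.
have : 0 <= \sum_(i < n.+1) (modc (a i) - t * (w i * `|y i|)) ^+ 2 / w i.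
  by apply: sumr_ge0 => i _; rewrite divr_ge0 ?sqr_ge0 // ltW // w_gt0 // leq_ord.
have -> : \sum_(i < n.+1) (modc (a i) - t * (w i * `|y i|)) ^+ 2 / w i =
   \sum_(i < n.+1) modc (a i) ^+ 2 / w i
   - 2 * t * \sum_(i < n.+1) modc (a i) * `|y i| + t ^+ 2 * B.
  rewrite /B -y2 !mulr_sumr -sumrB -big_split /=; apply: eq_bigr => i _.
  rewrite -(real_normK (num_real (y i))).
  by field; rewrite lt0r_neq0 // w_gt0 // leq_ord.
have := ler_wpM2l t0 a0_le.
have tB : t * B = X by rewrite /t divfK ?lt0r_neq0.
rewrite -/X (_ : X ^+ 2 / _ = t * X); last by rewrite /t -/B; ring.
rewrite (_ : t ^+ 2 * B = t * X); last by rewrite -tB; ring.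
set S := \sum_(i < n.+1) modc (a i) * _; set T := \sum_(i < n.+1) _ / _.
by rewrite -mulrA; lra.
Qed.

(** Isolating the term of index [0] gives [|a_0| K(0)^2 <= M |a_0| (K(0) - K(0)^2)], where [M] is
    the maximum; dividing by [|a_0| K(0)] gives [K(0) <= M (1 - K(0))]. *)
Lemma kernel_sup_bound (R : realType) (n : nat) (a : nat -> CC R) (K : nat -> R) :
  a 0%N != 0 -> \sum_(i < n.+1) K i ^+ 2 = K 0%N -> K 0%N < 1 ->
  \sum_(i < n.+1) a i * (K i ^+ 2)%:C = 0 ->
  (1 - K 0%N)^-1 <= 1 + \big[Num.max/0]_(1 <= k < n.+1) modc (a k / a 0%N).
Proof.
move=> a0 K2 K1 aK; set M := \big[Num.max/0]_(_ <= k < _) _.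
have K0 : 0 <= K 0%N by rewrite -K2 sumr_ge0 // => i _; exact: sqr_ge0.
have M0 : 0 <= M by exact: bigmax_ge_id.
have X0 : 0 < modc (a 0%N).
  rewrite lt_neqAle modc_ge0 andbT; apply: contra a0 => /eqP x0.
  by rewrite -normr_eq0 modcE -x0.
have aM k : (0 < k <= n)%N -> modc (a k) <= M * modc (a 0%N).
  move=> kn; rewrite -{1}(divfK a0 (a k)) modcM ler_wpM2r ?modc_ge0 //.
  by apply: (le_bigmax_seq _ _ _ (fun k => modc (a k / a 0%N))) => //; rewrite mem_index_iota ltnS.
have h : K 0%N * K 0%N <= M * (1 - K 0%N) * K 0%N.
  rewrite -(ler_pM2l X0).
  have e : a 0%N * (K 0%N ^+ 2)%:C = - \sum_(i < n) a i.+1 * (K i.+1 ^+ 2)%:C.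
    by apply/eqP; rewrite -addr_eq0; move: aK; rewrite big_ord_recl => ->.
  have := congr1 (@modc R) e; rewrite modcM modc_real ger0_norm ?sqr_ge0 // expr2 => ->.
  have -> (z : CC R) : modc (- z) = modc z by rewrite /modc normrN.
  apply: (le_trans (ler_modc_sum _ _)).
  have -> : modc (a 0%N) * (M * (1 - K 0%N) * K 0%N) =
      \sum_(i < n) M * modc (a 0%N) * K i.+1 ^+ 2.
    rewrite -mulr_sumr; move: K2; rewrite big_ord_recl /=; set S := \sum_(i < n) _ => K2.
    have -> : S = K 0%N - K 0%N ^+ 2 by rewrite -{1}K2 addrAC subrr add0r.
    by ring.
  apply: ler_sum => i _; rewrite modcM modc_real ger0_norm ?sqr_ge0 //.
  by rewrite ler_wpM2r ?sqr_ge0 // aM /= ?ltn_ord.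
have B0 : 0 < 1 - K 0%N by rewrite subr_gt0.
rewrite -[X in X <= _]mul1r ler_pdivrMr //.
(* If [K(0) = 0] no division is possible, but the claim reduces to [1 <= 1 + M]. *)
have [k0|k0] := eqVneq (K 0%N) 0; first by rewrite k0 subr0 mulr1; lra.
have : K 0%N <= M * (1 - K 0%N) by rewrite -(ler_pM2r (x := K 0%N)) // lt_neqAle eq_sym k0.
lra.
Qed.

(** As [mu <= n], the partial sum omits at least the term [q^n > 0] of [(1 + q)^n]. *)
Lemma binomial_partial_sum_lt (R : realType) (n mu : nat) (q : R) :
  0 < q -> (mu <= n)%N -> (1 + q) ^- n * (\sum_(i < mu) 'C(n, i)%:R * q ^+ i) < 1.
Proof.
move=> q0 mun; have q1 : 0 < (1 + q) ^+ n by rewrite exprn_gt0 // addr_gt0.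
rewrite mulrC ltr_pdivrMr // mul1r exprDn big_ord_recr /= subnn binn expr1n !mul1r.
apply: (@le_lt_trans _ _ (\sum_(i < n) 'C(n, i)%:R * q ^+ i)).
  rewrite (big_ord_widen n (fun i => 'C(n, i)%:R * q ^+ i)) // big_mkcond /=.
  apply: ler_sum => i _; case: ifP => // _.
  by rewrite mulr_ge0 // exprn_ge0 // ltW.
under [X in X + _]eq_bigr => i _ do rewrite expr1n mul1r -mulr_natl.
by rewrite ltrDl exprn_gt0.
Qed.

Theorem theorem3 (R : realType) (n : nat) (c : CC R) (F : nat -> CC R -> CC R)
  (a : nat -> CC R) (mu : nat) :
  Delta_basis n c F ->
  a 0%N != 0 ->
  (1 <= mu)%N ->
  (forall j, (j < mu)%N -> derive1n j (lincomb n a F) c = 0) ->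
  derive1n mu (lincomb n a F) c != 0 ->
  let m := (mu.+1)./2 in
  [/\ \sum_(i < n.+1) modc (a i) ^+ 2
        >= ((n - mu)`!%:R * (n + mu)`!%:R / (n`!%:R ^+ 2)) * modc (a 0%N) ^+ 2,
      ((n - mu)`!%:R * (n + mu)`!%:R / (n`!%:R ^+ 2)) * modc (a 0%N) ^+ 2
        >= expR (2 * mu%:R ^+ 2 / (2 * n%:R + 1)) * modc (a 0%N) ^+ 2,
      1 + \big[Num.max/0]_(1 <= k < n.+1) modc (a k / a 0%N)
        >= (n - m)`!%:R * (n + m)`!%:R / (n`!%:R ^+ 2),
      (n - m)`!%:R * (n + m)`!%:R / (n`!%:R ^+ 2)
        >= expR (2 * m%:R ^+ 2 / (2 * n%:R + 1)) :> R
    & forall q : R, 0 < q ->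
        \sum_(i < n.+1) modc (a i) ^+ 2 * q ^- i / 'C(n, i)%:R
        >= modc (a 0%N) ^+ 2 /
           (1 - (1 + q) ^- n * \sum_(i < mu) 'C(n, i)%:R * q ^+ i)].
Proof.
move=> DF a0 mu0 dp _ m.
have mun := Delta_basis_multiplicity_le DF a0 dp.
have aK : forall K : {poly R}, (size K <= mu)%N ->
    \sum_(i < n.+1) a i * (K.[i%:R])%:C = 0.
  apply: real_moment_eq0 => Q sQ.
  exact: (@Delta_basis_moment_eq0 R n c F a mu) (leqW mun) dp sQ.
have fact_gt0R k : 0 < k`!%:R :> R by rewrite ltr0n fact_gt0.
have ratio_gt0 k : 0 < n`!%:R ^+ 2 / ((n - k)`!%:R * (n + k)`!%:R) :> R.
  by rewrite divr_gt0 ?exprn_gt0 ?mulr_gt0.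
have m0 : (0 < m)%N by rewrite half_gt0.
have mmu : (m.*2 <= mu.+1)%N by rewrite -[leqRHS]odd_double_half leq_addl.
have mn : (m <= n)%N by lia.
split.
- have [K [sK K2 K0]] := @chebyshev_kernel R n mu mun mu0.
  have := @kernel_l2_bound R n a (fun=> 1) (fun i => K.[i%:R]).
  rewrite /= K0 invf_div mulrC => H.
  rewrite (le_trans (H _ _ _ _ _)) //.
  + by rewrite -K2; apply: eq_bigr => i _; rewrite mul1r.
  + by rewrite -subr_gt0 K0.
  + exact: aK.
  + by apply: ler_sum => i _; rewrite divr1.
- by rewrite ler_wpM2r ?sqr_ge0 // expR_le_fact_ratio.
- have [K [sK K2 K0]] := @chebyshev_kernel R n m mn m0.
  have := @kernel_sup_bound R n a (fun i => K.[i%:R]) a0 K2.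
  rewrite /= K0 invf_div; apply; first by rewrite -subr_gt0 K0.
  rewrite -[RHS](aK (K ^+ 2)); first by apply: eq_bigr => i _; rewrite horner_exp.
  (* [K ^+ 2] has size at most [2m - 1], and [2m <= mu + 1] by the choice of [m], so the moment
     condition applies to it. *)
  rewrite expr2 (leq_trans (size_polyMleq _ _)) // -subn1 leq_subLR add1n.
  by rewrite (leq_trans (leq_add sK sK)) // addnn.
- exact: expR_le_fact_ratio.
move=> q q0; have q1 : 1 + q != 0 by rewrite lt0r_neq0 // addr_gt0.
have [K [sK K2 K0]] := @krawtchouk_kernel R q n mu q1.
have := @kernel_l2_bound R n a (fun i => 'C(n, i)%:R * q ^+ i) (fun i => K.[i%:R]).
rewrite /= K0 => H; rewrite (le_trans (H _ _ _ _ _)) //.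
- by move=> i ni; rewrite mulr_gt0 ?exprn_gt0 // ltr0n bin_gt0.
- by rewrite bin0 mul1r.
- by rewrite K2.
- exact: binomial_partial_sum_lt.
- exact: aK.
- by apply: ler_sum => i _; rewrite invfM mulrA mulrAC.
Qed.
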